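(* Let $I\subseteq\mathbb{R}_0$ be an interval, let $f:I\to\mathbb{R}$ be differentiable on $I^\circ$, let $a,b\in I$ with $a<b$, let $f'\in L[a,b]$, and let $0\le\lambda,\mu\le1$. Let $q\ge1$ and suppose that $|f'(x)|^q$ is an extended $s$-convex function on $[a,b]$ for some fixed $s\in[-1,1]$. (1) If $-1<s\le1$, then $$\begin{aligned} &\left|\frac{\lambda f(a)+\mu f(b)}2+\frac{2-\lambda-\mu}2f\left(\frac{a+b}2\right)-\frac1{b-a}\int_a^bf(x)\,dx\right|\\ &\le\frac{b-a}{2^{s/q+2}}\left[\frac1{(s+1)(s+2)}\right]^{1/q}\Big\{\left(\tfrac12-\lambda+\lambda^2\right)^{1-1/q}\Big[\big(2(2-\lambda)^{s+2}+[(s+2)\lambda-2]2^{s+1}+(s+2)\lambda-s-3\big)|f'(a)|^q\\ &\qquad+\big(2\lambda^{s+2}-(s+2)\lambda+s+1\big)|f'(b)|^q\Big]^{1/q}\\ &\quad+\left(\tfrac12-\mu+\mu^2\right)^{1-1/q}\Big[\big(2\mu^{s+2}-(s+2)\mu+s+1\big)|f'(a)|^q\\ &\qquad+\big(2(2-\mu)^{s+2}+[(s+2)\mu-2]2^{s+1}+(s+2)\mu-s-3\big)|f'(b)|^q\Big]^{1/q}\Big\}. \end{aligned}$$ (2) If $s=-1$, then $$\left|f\left(\frac{a+b}2\right)-\frac1{b-a}\int_a^bf(x)\,dx\right|\le\frac{b-a}{2^{3-2/q}}\Big\{\big[(2\ln2-1)|f'(a)|^q+|f'(b)|^q\big]^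{1/q}+\big[|f'(a)|^q+(2\ln2-1)|f'(b)|^q\big]^{1/q}\Big\}.$$
   Context: $\mathbb{R}_0=[0,\infty)$; $I^\circ$ is the interior of the interval $I$; $L[a,b]$ is the set of Lebesgue integrable functions on $[a,b]$. For $s\in[-1,1]$, a function $g:J\to\mathbb{R}_0$ on an interval $J\subseteq\mathbb{R}_0$ is called extended $s$-convex if $g(tx+(1-t)y)\le t^sg(x)+(1-t)^sg(y)$ for all $x,y\in J$ and $t\in(0,1)$. The hypothesis on $|f'|^q$ presupposes that $f'$ exists on all of $[a,b]$; if $a$ or $b$ is an endpoint of $I$, the derivative there is one-sided. *)

(* Defs.v *)
From mathcomp Require Import all_boot all_order all_algebra.
From mathcomp Require Import all_classical all_reals all_analysis.

Set Implicit Arguments.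
Unset Strict Implicit.
Unset Printing Implicit Defensive.

Import Order.TTheory GRing.Theory Num.Theory.
Import numFieldNormedType.Exports.

Local Open Scope classical_set_scope.
Local Open Scope ring_scope.

(* Derivative of a function [f : I -> R], represented by a total function whose
   values outside [I] are irrelevant: the increments [h] are restricted to those
   with [h + x] in [I]. For [x] in the interior of [I] this is [f^`() x] (see
   [derive1_inE]); if [x] is an endpoint of [I], it is the one-sided derivative. *)
Definition derivable_in (R : realType) (I : set R) (f : R -> R) (x : R) : Prop :=
  cvg (h^-1 *: (f (h + x) - f x) @[h --> within [set h | I (h + x)] 0^']).

Definition derive1_in (R : realType) (I : set R) (f : R -> R) (x : R) : R :=
  lim (h^-1 *: (f (h + x) - f x) @[h --> within [set h | I (h + x)] 0^']).

Lemma within_dnbhs0_interior (R : realType) (I : set R) (x : R) : I° x ->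
  within [set h | I (h + x)] 0^' = 0^' :> set_system R.
Proof.
move=> Ix.
have I0 : \forall h \near (0 : R)^', I (h + x).
  apply: nbhs_dnbhs.
  have : h + x @[h --> (0 : R)] --> x.
    by rewrite -[X in _ --> X]add0r; apply: cvgD; [exact: cvg_id|exact: cvg_cst].
  by apply; exact: Ix.
apply/seteqP; split => P; rewrite /within/= => PP.
  by apply: filterS2 I0 PP => h Ih; apply.
by apply: filterS PP.
Qed.

Lemma derive1_inE (R : realType) (I : set R) (f : R -> R) (x : R) : I° x ->
  derive1_in I f x = f^`()%classic x.
Proof.
by move=> Ix; rewrite /derive1_in within_dnbhs0_interior.
Qed.

Lemma derivable_inE (R : realType) (I : set R) (f : R -> R) (x : R) : I° x ->
  derivable_in I f x <-> derivable f x 1.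
Proof.
move=> Ix; rewrite /derivable_in within_dnbhs0_interior// /derivable.
suff -> : (fun h : R => h^-1 *: (f (h + x) - f x)) =
          (fun h => h^-1 *: (f (h *: 1 + x) - f x)) by [].
by apply/funext => h; rewrite [h%:A]mulr1.
Qed.

(* [t `^ s] is the real power, only evaluated at positive bases here. *)
Definition extended_s_convex (R : realType) (s : R) (J : set R) (g : R -> R) :
    Prop :=
  [/\ -1 <= s <= 1,
      is_interval J /\ J `<=` `[0, +oo[,
      (forall x, J x -> 0 <= g x) &
      forall x y t, J x -> J y -> 0 < t < 1 ->
        g (t * x + (1 - t) * y) <= t `^ s * g x + (1 - t) `^ s * g y].

(* Main.v *)
(* On each half of [a, b], rescaled to [0, 1] with t = 0 at the outer endpoint,
   the error is the integral of (t - lambda) phi'(t), where phi is f in the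
   variable t. No integration of f' is needed: the function
   (t - lambda) phi - Phi, with Phi a primitive of phi, has derivative
   (t - lambda) phi', and Young's inequality
     m^(1/q) <= (1 - 1/q) k + k^(1 - q) m / q
   applied to the s-convexity bound m of |f'|^q dominates |t - lambda| |phi'| by
   a combination of powers of t and 2 - t with explicit primitives, so that the
   mean value theorem applies. Optimizing over k > 0 gives the power-mean
   (Hoelder) form of the estimate. *)
Require Import Defs.
From mathcomp Require Import all_boot all_order all_algebra.
From mathcomp Require Import all_classical all_reals all_analysis.
From mathcomp Require Import ring lra.

Set Implicit Arguments.
Unset Strict Implicit.
Unset Printing Implicit Defensive.

Import Order.TTheory GRing.Theory Num.Theory.
Import numFieldNormedType.Exports.

Local Open Scope classical_set_scope.
Local Open Scope ring_scope.

(** * Mean value estimates against the kernel [t - l] *)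

(** Both [K - H] and [K + H] have nonnegative derivatives, so the mean value theorem makes both of
    their increments nonnegative. *)
Lemma norm_increment_le (R : realType) (H K dH dK : R -> R) (u v : R) :
  u <= v ->
  {within `[u, v], continuous H} -> {within `[u, v], continuous K} ->
  (forall x : R, x \in `]u, v[ -> is_derive x 1 H (dH x)) ->
  (forall x : R, x \in `]u, v[ -> is_derive x 1 K (dK x)) ->
  (forall x : R, x \in `]u, v[ -> `|dH x| <= dK x) ->
  `|H v - H u| <= K v - K u.
Proof.
rewrite le_eqVlt => /predU1P[<-|uv] cH cK HH HK HdK.
  by rewrite !subrr normr0.
have {}HdK (x : R) : x \in `]u, v[ -> - dK x <= dH x <= dK x.
  by move=> /HdK; rewrite ler_norml.
have [x xuv Ex] : exists2 x, x \in `]u, v[ &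
    (K - H) v - (K - H) u = (dK x - dH x) * (v - u).
  apply: (@MVT _ (K - H) (fun x : R => dK x - dH x) u v) => //.
    by move=> x xuv; exact: is_deriveB (HK _ xuv) (HH _ xuv).
  exact: within_continuousB.
have [y yuv Ey] : exists2 y, y \in `]u, v[ &
    (K + H) v - (K + H) u = (dK y + dH y) * (v - u).
  apply: (@MVT _ (K + H) (fun x : R => dK x + dH x) u v) => //.
    by move=> y yuv; exact: is_deriveD (HK _ yuv) (HH _ yuv).
  exact: within_continuousD.
have /andP[y1 y2] := HdK _ yuv; have /andP[x1 x2] := HdK _ xuv.
have Px : 0 <= (dK x - dH x) * (v - u) by rewrite mulr_ge0//; lra.
have Py : 0 <= (dK y + dH y) * (v - u) by rewrite mulr_ge0//; lra.
move: Ex Ey; rewrite !fctE => Ex Ey.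
by rewrite ler_norml; lra.
Qed.

Lemma within_continuousM (R : realType) (A : set R) (g h : R -> R) :
  {within A, continuous g} -> {within A, continuous h} ->
  {within A, continuous (fun x => g x * h x)}.
Proof. by move=> cg ch x; apply: cvgM; [exact: cg|exact: ch]. Qed.

Lemma within_continuous_comp_in (R : realType) (A B : set R) (g h : R -> R) :
  {homo h : x / A x >-> B x} -> {within A, continuous h} ->
  {within B, continuous g} -> {within A, continuous (g \o h)}.
Proof.
move=> AB /subspace_continuousP ch /subspace_continuousP cg.
apply/subspace_continuousP => x Ax.
apply: cvg_trans (cg _ (AB _ Ax)) => P /= BP.
have := ch _ Ax _ BP; rewrite /nbhs/= /within/= => hP.
by apply: filterS hP => z + Az; apply => //; exact: AB.
Qed.

(* [(t - l) * phi t - Phi t] has derivative [(t - l) * dphi t], dominated by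
   that of [- G] before [l] and by that of [G] after it. *)
Lemma peano_kernel_bound (R : realType) (phi Phi G dphi w : R -> R) (l : R) :
  0 <= l <= 1 ->
  {within `[0, 1], continuous phi} -> {within `[0, 1], continuous Phi} ->
  {within `[0, 1], continuous G} ->
  (forall t : R, t \in `]0, 1[ -> is_derive t 1 phi (dphi t)) ->
  (forall t : R, t \in `]0, 1[ -> is_derive t 1 Phi (phi t)) ->
  (forall t : R, t \in `]0, 1[ -> is_derive t 1 G ((t - l) * w t)) ->
  (forall t : R, t \in `]0, 1[ -> `|dphi t| <= w t) ->
  `|l * phi 0 + (1 - l) * phi 1 - (Phi 1 - Phi 0)| <= G 0 + G 1 - 2 * G l.
Proof.
move=> /andP[l0 l1] cphi cPhi cG dphiE dPhiE dGE wE.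
pose H (t : R) : R := (t - l) * phi t - Phi t.
have cH : {within `[0, 1], continuous H}.
  apply: within_continuousB => //; apply: within_continuousM => //.
  apply: continuous_subspaceT => x.
  by apply: cvgB; [exact: cvg_id|exact: cvg_cst].
have HH (t : R) : t \in `]0, 1[ -> is_derive t 1 H ((t - l) * dphi t).
  move=> t01; have := is_deriveB (is_deriveM (is_deriveB
    (is_derive_id t 1) (is_derive_cst l t 1)) (dphiE t t01)) (dPhiE t t01).
  move=> h; apply: (is_derive_eq h).
  by rewrite !fctE subr0 /GRing.scale/= mulr1; ring.
have sub1 (x : R) : x \in `]0, l[ -> x \in `]0, 1[.
  by rewrite !in_itv/= => /andP[? ?]; apply/andP; split; lra.
have sub2 (x : R) : x \in `]l, 1[ -> x \in `]0, 1[.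
  by rewrite !in_itv/= => /andP[? ?]; apply/andP; split; lra.
have cG1 : {within `[0, l], continuous G}.
  by apply: continuous_subspaceW cG; apply: subset_itvl.
have cG2 : {within `[l, 1], continuous G}.
  by apply: continuous_subspaceW cG; apply: subset_itvr.
have cH1 : {within `[0, l], continuous H}.
  by apply: continuous_subspaceW cH; apply: subset_itvl.
have cH2 : {within `[l, 1], continuous H}.
  by apply: continuous_subspaceW cH; apply: subset_itvr.
have cNG1 : {within `[0, l], continuous (fun t : R => - G t)}.
  by move=> x; apply: cvgN; exact: cG1.
have dNG (x : R) (xl : x \in `]0, l[) :
    is_derive x 1 (fun t : R => - G t) (- ((x - l) * w x)).
  exact: is_deriveN (dGE x (sub1 x xl)).
have leN (x : R) : x \in `]0, l[ -> `|(x - l) * dphi x| <= - ((x - l) * w x).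
  move=> xl; have := wE x (sub1 _ xl).
  move: xl; rewrite in_itv/= => /andP[x0 xl] wx.
  by rewrite normrM ltr0_norm ?subr_lt0// -mulNr ler_wpM2l//; lra.
have leP (x : R) : x \in `]l, 1[ -> `|(x - l) * dphi x| <= (x - l) * w x.
  move=> xl; have := wE x (sub2 _ xl).
  move: xl; rewrite in_itv/= => /andP[x0 xl] wx.
  by rewrite normrM gtr0_norm ?subr_gt0// ler_wpM2l//; lra.
have le1 := norm_increment_le l0 cH1 cNG1
  (fun x xl => HH x (sub1 x xl)) dNG leN.
have le2 := norm_increment_le l1 cH2 cG2 (fun x xl => HH x (sub2 x xl))
  (fun x xl => dGE x (sub2 x xl)) leP.
(* The quantity to bound is [H 1 - H 0]. Split at [l], its two parts are bounded by [G 0 - G l] and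
   [G 1 - G l]. *)
have -> : l * phi 0 + (1 - l) * phi 1 - (Phi 1 - Phi 0) =
    (H l - H 0) + (H 1 - H l) by rewrite /H; ring.
apply: le_trans (ler_normD _ _) _; apply: le_trans (lerD le1 le2) _.
lra.
Qed.

(** * Young's inequality and the power-mean estimate *)

(* The tangent line at [k `^ q] of the concave function [m |-> m `^ (1 / q)]. *)
Lemma powRV_le_tangent (R : realType) (q k m : R) :
  1 <= q -> 0 < k -> 0 <= m ->
  m `^ (1 / q) <= (1 - 1 / q) * k + k / k `^ q / q * m.
Proof.
(* For [q = 1] the conjugate exponent is infinite; the bound is then an equality. *)
rewrite le_eqVlt => /predU1P[<-|q1] k0 m0.
  rewrite !divr1 subrr mul0r add0r !powRr1 ?(ltW k0)//.
  by rewrite divff ?mul1r// gt_eqF.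
have q0 : 0 < q by lra.
have qneq0 : q != 0 by rewrite gt_eqF.
have kq0 : 0 < k `^ q by rewrite powR_gt0.
(* Scaling reduces the claim to [k = 1], which is Young's inequality for the factors [x] to the
   power [1 / q] and 1, with exponents [q] and [(1 - 1 / q)^-1]. *)
pose x := m / k `^ q.
have x0 : 0 <= x by rewrite divr_ge0// ltW.
have -> : m = k `^ q * x by rewrite mulrC divfK ?gt_eqF.
rewrite powRM ?(ltW kq0)// -powRrM mulrCA divff// mulr1 powRr1 ?(ltW k0)//.
have : x `^ (1 / q) * 1 <= (x `^ (1 / q)) `^ q / q +
    1 `^ (1 - 1 / q)^-1 / (1 - 1 / q)^-1.
  have h : 0 < 1 - 1 / q by rewrite subr_gt0 ltr_pdivrMr// mul1r.
  apply: conjugate_powR => //; rewrite ?powR_ge0// ?invr_gt0//.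
  by rewrite invrK div1r; lra.
rewrite mulr1 powR1 -powRrM divfK// powRr1// invrK mul1r => h.
have -> : (1 - q^-1) * k + k / k `^ q / q * (k `^ q * x) =
    k * (x / q + 1 * (1 - q^-1)) by field; rewrite qneq0 gt_eqF.
by rewrite ler_pM2l.
Qed.

(** The right side is least when [k] to the power [q] is [N / P]; its value [k * P] is then the
    product in the conclusion. For [N = 0] this [k] is not positive, and a limit replaces it. *)
Lemma tangent_bound_optimize (R : realType) (q L P N : R) :
  1 <= q -> 0 < P -> 0 <= N ->
  (forall k : R, 0 < k -> L <= (1 - 1 / q) * k * P + k / k `^ q / q * N) ->
  L <= P `^ (1 - 1 / q) * N `^ (1 / q).
Proof.
move=> q1 P0 N0 LPN.
have q0 : 0 < q by lra.
have qneq0 : q != 0 by rewrite gt_eqF.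
have [N_eq0|N_neq0] := eqVneq N 0.
  have qV1 : 0 <= 1 - 1 / q by rewrite subr_ge0 ler_pdivrMr// mul1r.
  rewrite N_eq0 powR0 ?mulr0; last by rewrite mul1r invr_eq0.
  (* The choice [k = e / P] brings the right side down to at most [e]. *)
  apply/ler_addgt0Pl => e e0; rewrite addr0.
  apply: le_trans (LPN (e / P) (divr_gt0 e0 P0)) _.
  rewrite N_eq0 mulr0 addr0 -mulrA divfK ?gt_eqF//.
  rewrite -[leRHS]mul1r ler_wpM2r ?(ltW e0)// gerBl.
  by rewrite divr_ge0// ltW.
have {}N0 : 0 < N by rewrite lt_neqAle eq_sym N_neq0.
pose k := (N / P) `^ (1 / q).
have k0 : 0 < k by rewrite powR_gt0// divr_gt0.
have kq : k `^ q = N / P by rewrite /k -powRrM divfK// powRr1// divr_ge0// ltW.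
apply: le_trans (LPN k k0) _; rewrite kq.
have -> : (1 - 1 / q) * k * P + k / (N / P) / q * N = k * P.
  by field; rewrite qneq0 !gt_eqF.
rewrite /k powRM ?invr_ge0 ?(ltW P0) ?(ltW N0)// powRB; last first.
  by apply/implyP => _; rewrite gt_eqF.
rewrite powRr1 ?(ltW P0)// -(@powR_inv1 _ P) ?(ltW P0)// -powRrM mulN1r powRN.
rewrite le_eqVlt; apply/predU1P; left; ring.
Qed.

Lemma within_continuous_cst (R : realType) (A : set R) (c : R) :
  {within A, continuous (fun _ : R => c)}.
Proof. by apply: continuous_subspaceT => x; exact: cvg_cst. Qed.

Lemma within_continuous_id (R : realType) (A : set R) :
  {within A, continuous (fun x : R => x)}.
Proof. by apply: continuous_subspaceT => x; exact: cvg_id. Qed.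

(** The combination of values of [GM] stands for the integral of [|t - l| * M t] over [0, 1]. Its
    sign follows from the kernel bound with [phi = Phi = 0]. *)
Lemma kernel_weight_ge0 (R : realType) (M GM : R -> R) (l : R) :
  0 <= l <= 1 -> {within `[0, 1], continuous GM} ->
  (forall t : R, t \in `]0, 1[ -> is_derive t 1 GM ((t - l) * M t)) ->
  (forall t : R, t \in `]0, 1[ -> 0 <= M t) ->
  0 <= GM 0 + GM 1 - 2 * GM l.
Proof.
move=> l01 cGM dGM M0.
have c0 := @within_continuous_cst R `[0, 1] 0.
have d0 (t : R) : t \in `]0, 1[ -> is_derive t 1 (fun _ : R => 0) (0 : R).
  by move=> _; exact: is_derive_cst.
have M0' (t : R) : t \in `]0, 1[ -> `|0 : R| <= M t.
  by move=> t01; rewrite normr0 M0.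
have := peano_kernel_bound l01 c0 c0 cGM d0 d0 dGM M0'.
by apply: le_trans; exact: normr_ge0.
Qed.

(** This is the Hoelder estimate with respect to the measure [|t - l| dt] on [0, 1]: its total mass
    is [1 / 2 - l + l ^+ 2], and [M] enters through a primitive [GM] of [(t - l) * M t]. *)
Lemma unit_kernel_bound (R : realType) (phi Phi dphi M GM : R -> R)
    (h l q : R) :
  0 < h -> 1 <= q -> 0 <= l <= 1 ->
  {within `[0, 1], continuous phi} -> {within `[0, 1], continuous Phi} ->
  {within `[0, 1], continuous GM} ->
  (forall t : R, t \in `]0, 1[ -> is_derive t 1 phi (dphi t)) ->
  (forall t : R, t \in `]0, 1[ -> is_derive t 1 Phi (phi t)) ->
  (forall t : R, t \in `]0, 1[ -> is_derive t 1 GM ((t - l) * M t)) ->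
  (forall t : R, t \in `]0, 1[ -> 0 <= M t) ->
  (forall t : R, t \in `]0, 1[ -> `|dphi t| <= h * M t `^ (1 / q)) ->
  `|l * phi 0 + (1 - l) * phi 1 - (Phi 1 - Phi 0)| <=
  h * ((1 / 2 - l + l ^+ 2) `^ (1 - 1 / q) *
       (GM 0 + GM 1 - 2 * GM l) `^ (1 / q)).
Proof.
move=> h0 q1 l01 cphi cPhi cGM dphiE dPhiE dGME M0 dphiM.
set L := `|_|.
rewrite mulrC -ler_pdivrMr//.
have N0 := kernel_weight_ge0 l01 cGM dGME M0.
apply: tangent_bound_optimize => //.
  rewrite (_ : _ + _ = (l - 1 / 2) ^+ 2 + 1 / 4); last by field.
  by rewrite ltr_wpDl// sqr_ge0.
move=> k k0.
rewrite ler_pdivrMr//.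
(* These are the coefficients of the tangent line at [k], scaled by [h], so that [w] dominates
   [|dphi|]. *)
pose c1 := h * ((1 - 1 / q) * k).
pose c2 := h * (k / k `^ q / q).
pose w (t : R) : R := c1 + c2 * M t.
pose G (t : R) : R := c1 * (t * t / 2 - l * t) + c2 * GM t.
have cG : {within `[0, 1], continuous G}.
  have cid := @within_continuous_id R `[0, 1].
  have cst c := @within_continuous_cst R `[0, 1] c.
  apply: within_continuousD; apply: within_continuousM => //.
  apply: within_continuousB; apply: within_continuousM => //.
  exact: within_continuousM.
have dG (t : R) : t \in `]0, 1[ -> is_derive t 1 G ((t - l) * w t).
  move=> t01.
  have hd := is_deriveD (is_deriveM (is_derive_cst c1 t 1) (is_deriveB
    (is_deriveM (is_deriveM (is_derive_id t 1) (is_derive_id t 1))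
      (is_derive_cst (2^-1 : R) t 1))
    (is_deriveM (is_derive_cst l t 1) (is_derive_id t 1))))
    (is_deriveM (is_derive_cst c2 t 1) (dGME t t01)).
  apply: (is_derive_eq hd).
  by rewrite !fctE /GRing.scale/= /w; field.
have dphiw (t : R) : t \in `]0, 1[ -> `|dphi t| <= w t.
  move=> t01; apply: le_trans (dphiM t t01) _.
  rewrite /w /c1 /c2 -mulrA -mulrDr ler_pM2l//.
  by rewrite powRV_le_tangent// M0.
have := peano_kernel_bound l01 cphi cPhi cG dphiE dPhiE dG dphiw.
(* The polynomial part of [G] contributes [c1] times the mass [1 / 2 - l + l ^+ 2]. *)
rewrite -/L /G /c1 /c2 => /le_trans; apply.
have q0 : q != 0 by rewrite gt_eqF//; lra.
have kq0 : k `^ q != 0 by rewrite gt_eqF// powR_gt0.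
by rewrite le_eqVlt; apply/predU1P; left; field; rewrite ?q0 ?kq0.
Qed.

(** * Real powers and affine changes of variable *)

(** The derivative formula covers positive [t] only; at 0 continuity is the one-sided limit, with
    value 0 because [p] is positive. *)
Lemma within_continuous_powR (R : realType) (p u : R) : 0 < p -> 0 < u ->
  {within `[0, u], continuous (fun t : R => t `^ p)}.
Proof.
move=> p0 u0.
have cp (t : R) : 0 < t -> {for t, continuous (fun t : R => t `^ p)}.
  move=> t0; apply/differentiable_continuous/derivable1_diffP.
  by apply: ex_derive; exact: is_derive1_powR.
apply/(continuous_within_itvP _ u0); split.
- by move=> t; rewrite in_itv/= => /andP[t0 _]; exact: cp.
- by rewrite powR0 ?gt_eqF//; exact: powR_cvg0.
- by apply: cvg_at_left_filter; exact: cp.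
Qed.

(** At [x = 0] positivity of [p + 1] matters, since 0 to the power 0 is 1. *)
Lemma powRS (R : realType) (x p : R) : 0 <= x -> 0 < p + 1 ->
  x `^ (p + 1) = x * x `^ p.
Proof. by move=> x0 p0; rewrite -(mulr_powRB1 x0 p0) addrK. Qed.

Lemma is_derive_powRS (R : realType) (x p : R) : 0 < x ->
  is_derive x 1 (fun t : R => t `^ (p + 1)) ((p + 1) * x `^ p).
Proof.
move=> x0; apply: (is_derive_eq (is_derive1_powR _ x0)).
by rewrite addrK.
Qed.

Lemma is_derive_affine (R : realType) (g : R -> R) (c k x d : R) :
  is_derive (c + x * k) 1 g d ->
  is_derive x 1 (fun t : R => g (c + t * k)) (d * k).
Proof.
move=> gd.
have h : is_derive x 1 (fun t : R => c + t * k) k.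
  have h := is_deriveD (is_derive_cst c x 1)
    (is_deriveM (is_derive_id x 1) (is_derive_cst k x 1)).
  by apply: (is_derive_eq h); rewrite !fctE /GRing.scale/=; ring.
exact: (@is_derive1_comp R g (fun t : R => c + t * k) x d k gd h).
Qed.

Lemma is_derive_reflect (R : realType) (g : R -> R) (c x d : R) :
  is_derive (c - x) 1 g d -> is_derive x 1 (fun t : R => g (c - t)) (- d).
Proof.
have E (t : R) : c - t = c + t * -1 by rewrite mulrN1.
have -> : (fun t : R => g (c - t)) = (fun t : R => g (c + t * -1)).
  by apply/funext => t; rewrite E.
by rewrite E => gd; apply: (is_derive_eq (is_derive_affine gd)); rewrite mulrN1.
Qed.

(** The argument [2 - t] stays in [1, 2]; the larger interval matches the form of
    [within_continuous_powR]. *)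
Lemma within_continuous_reflect (R : realType) (g : R -> R) :
  {within `[0, 2], continuous g} ->
  {within `[0, 1], continuous (fun t : R => g (2 - t))}.
Proof.
apply: within_continuous_comp_in.
  by move=> t /=; rewrite !in_itv/= => /andP[? ?]; apply/andP; split; lra.
apply: within_continuousB; [exact: within_continuous_cst|].
exact: within_continuous_id.
Qed.

(** * Explicit weights for [-1 < s] and for [s = -1] *)

(* After [u = 2 - t], both terms of the weight have the primitive
   [(s + 1) u^(s + 2) - a (s + 2) u^(s + 1)] of [(s + 1) (s + 2) (u - a) u^s],
   with [a = 2 - l] and [a = l] respectively. *)
Lemma power_weight_bound (R : realType) (phi Phi dphi : R -> R)
    (A B h l q s : R) :
  0 < h -> 1 <= q -> 0 <= l <= 1 -> -1 < s -> 0 <= A -> 0 <= B ->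
  {within `[0, 1], continuous phi} -> {within `[0, 1], continuous Phi} ->
  (forall t : R, t \in `]0, 1[ -> is_derive t 1 phi (dphi t)) ->
  (forall t : R, t \in `]0, 1[ -> is_derive t 1 Phi (phi t)) ->
  (forall t : R, t \in `]0, 1[ ->
    `|dphi t| <= h * ((1 - t / 2) `^ s * A + (t / 2) `^ s * B) `^ (1 / q)) ->
  `|l * phi 0 + (1 - l) * phi 1 - (Phi 1 - Phi 0)| <=
  h * ((1 / 2 - l + l ^+ 2) `^ (1 - 1 / q) *
    ((2 `^ (- s) / ((s + 1) * (s + 2))) `^ (1 / q) *
      ((2 * (2 - l) `^ (s + 2) + ((s + 2) * l - 2) * 2 `^ (s + 1)
        + (s + 2) * l - s - 3) * A
       + (2 * l `^ (s + 2) - (s + 2) * l + s + 1) * B) `^ (1 / q))).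
Proof.
move=> h0 q1 l01 s1 A0 B0 cphi cPhi dphiE dPhiE dphiM.
have s10 : 0 < s + 1 by lra.
have s20 : 0 < s + 1 + 1 by lra.
(* Writing [s + 2] as two unit increments lets [powRS] and [is_derive_powRS] apply at both
   levels. *)
have s2E : s + 2 = s + 1 + 1 by ring.
have s1neq0 : s + 1 != 0 by rewrite gt_eqF.
have s2neq0 : s + 1 + 1 != 0 by rewrite gt_eqF.
rewrite s2E.
(* The power of 2 comes from the halves in [1 - t / 2] and [t / 2]; the denominator removes the
   constant produced by differentiating [U] and [V]. *)
set Q := 2 `^ (- s) / ((s + 1) * (s + 1 + 1)).
pose M (t : R) : R := 2 `^ (- s) * ((2 - t) `^ s * A + t `^ s * B).
pose U (u : R) : R :=
  (s + 1) * u `^ (s + 1 + 1) - (2 - l) * (s + 1 + 1) * u `^ (s + 1).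
pose V (t : R) : R :=
  (s + 1) * t `^ (s + 1 + 1) - l * (s + 1 + 1) * t `^ (s + 1).
(* Reflection restores the sign of the kernel: differentiating [U (2 - t)] gives the factor
   [- ((2 - t) - (2 - l)) = t - l]. *)
pose GM (t : R) : R := Q * A * U (2 - t) + Q * B * V t.
have cst1 c := @within_continuous_cst R `[0, 1] c.
have cst2 c := @within_continuous_cst R `[0, 2] c.
have cGM : {within `[0, 1], continuous GM}.
  apply: within_continuousD; apply: within_continuousM => //.
    apply: (@within_continuous_reflect _ U).
    by apply: within_continuousB; apply: within_continuousM => //;
      exact: within_continuous_powR.
  by apply: within_continuousB; apply: within_continuousM => //;
      exact: within_continuous_powR.
have dGM (t : R) : t \in `]0, 1[ -> is_derive t 1 GM ((t - l) * M t).
  rewrite in_itv/= => /andP[t0 t1].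
  have u0 : 0 < 2 - t by lra.
  have dpow (a x : R) : 0 < x -> is_derive x 1 (fun u : R =>
      (s + 1) * u `^ (s + 1 + 1) - a * (s + 1 + 1) * u `^ (s + 1))
      ((s + 1) * (s + 1 + 1) * (x - a) * x `^ s).
    move=> x0.
    have hd := is_deriveB
      (is_deriveM (is_derive_cst (s + 1 : R) x 1) (is_derive_powRS (s + 1) x0))
      (is_deriveM (is_derive_cst (a * (s + 1 + 1) : R) x 1)
        (is_derive_powRS s x0)).
    apply: (is_derive_eq hd).
    rewrite !fctE /GRing.scale/= (powRS (ltW x0) s10); ring.
  have hd := is_deriveD
    (is_deriveM (is_derive_cst (Q * A : R) t 1)
      (is_derive_reflect (dpow (2 - l) (2 - t) u0)))
    (is_deriveM (is_derive_cst (Q * B : R) t 1) (dpow l t t0)).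
  apply: (is_derive_eq hd).
  rewrite !fctE /GRing.scale/= /M /Q; field.
  by rewrite s1neq0 s2neq0.
have M0 (t : R) : t \in `]0, 1[ -> 0 <= M t.
  by move=> _; rewrite mulr_ge0 ?powR_ge0// addr_ge0// mulr_ge0// powR_ge0.
have dphiM' (t : R) : t \in `]0, 1[ -> `|dphi t| <= h * M t `^ (1 / q).
  move=> t01; apply: le_trans (dphiM t t01) _.
  move: t01; rewrite in_itv/= => /andP[t0 t1].
  rewrite le_eqVlt; apply/predU1P; left; congr (h * _ `^ _).
  have -> : 1 - t / 2 = (2 - t) * 2^-1 by field.
  have iv2 : (2^-1 : R) `^ s = 2 `^ (- s).
    by rewrite -(@powR_inv1 _ 2)// -powRrM mulN1r.
  rewrite !powRM ?invr_ge0//; try lra.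
  by rewrite iv2 /M; ring.
have /andP[l0 l1] := l01.
have u0 : 0 <= 2 - l by lra.
have Q0 : 0 < Q by rewrite divr_gt0 ?powR_gt0 ?mulr_gt0.
set Z := (X in _ <= h * (_ * (_ * X `^ _))).
have NE : GM 0 + GM 1 - 2 * GM l = Q * Z.
  rewrite /GM /U /V /Z subr0 (_ : 2 - 1 = 1); last by ring.
  rewrite !powR1 !powR0// (powRS l0 s20) (powRS u0 s20).
  rewrite (powRS (ler0n _ 2) s20); ring.
(* The sign of [Z], needed to split the power of [Q * Z], is read off from the integral it
   represents. *)
have Z0 : 0 <= Z.
  by rewrite -(pmulr_rge0 _ Q0) -NE (kernel_weight_ge0 l01 cGM dGM M0).
rewrite -powRM ?(ltW Q0)// -NE.
exact: unit_kernel_bound h0 q1 l01 cphi cPhi cGM dphiE dPhiE dGM M0 dphiM'.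
Qed.

(** With [l = 0] the kernel [t] cancels the pole of [2 / t], leaving the constant [2 * B]. The other
    term, [2 * A * t / (2 - t)], integrates to a logarithm of [2 - t], which is smooth on [0, 1]. *)
Lemma reciprocal_weight_bound (R : realType) (phi Phi dphi : R -> R)
    (A B h q : R) :
  0 < h -> 1 <= q -> 0 <= A -> 0 <= B ->
  {within `[0, 1], continuous phi} -> {within `[0, 1], continuous Phi} ->
  (forall t : R, t \in `]0, 1[ -> is_derive t 1 phi (dphi t)) ->
  (forall t : R, t \in `]0, 1[ -> is_derive t 1 Phi (phi t)) ->
  (forall t : R, t \in `]0, 1[ ->
    `|dphi t| <=
      h * ((1 - t / 2) `^ (- 1) * A + (t / 2) `^ (- 1) * B) `^ (1 / q)) ->
  `|phi 1 - (Phi 1 - Phi 0)| <=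
  h * ((1 / 2) `^ (1 - 1 / q) *
    (2 `^ (1 / q) * ((2 * ln 2 - 1) * A + B) `^ (1 / q))).
Proof.
move=> h0 q1 A0 B0 cphi cPhi dphiE dPhiE dphiM.
pose M (t : R) : R := 2 / (2 - t) * A + 2 / t * B.
pose U (u : R) : R := u - 2 * ln u.
pose GM (t : R) : R := 2 * A * U (2 - t) + 2 * B * t.
have dU (u : R) : 0 < u -> is_derive u 1 U (1 - 2 / u).
  move=> u0.
  have hd := is_deriveB (is_derive_id u 1)
    (is_deriveM (is_derive_cst (2 : R) u 1) (is_derive1_ln u0)).
  apply: (is_derive_eq hd).
  by rewrite !fctE /GRing.scale/= mulr0 addr0.
have dGM' (t : R) : t < 2 ->
    is_derive t 1 GM (2 * A * - (1 - 2 / (2 - t)) + 2 * B).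
  move=> t2; have u0 : 0 < 2 - t by lra.
  have hd := is_deriveD
    (is_deriveM (is_derive_cst (2 * A : R) t 1) (is_derive_reflect (dU _ u0)))
    (is_deriveM (is_derive_cst (2 * B : R) t 1) (is_derive_id t 1)).
  apply: (is_derive_eq hd).
  by rewrite !fctE /GRing.scale/= !mulr0 !addr0 mulr1.
have cGM : {within `[0, 1], continuous GM}.
  apply: derivable_within_continuous => t; rewrite in_itv/= => /andP[_ t1].
  by apply: (@ex_derive _ _ _ _ _ _ _ (dGM' t _)); lra.
have dGM (t : R) : t \in `]0, 1[ -> is_derive t 1 GM ((t - 0) * M t).
  rewrite in_itv/= => /andP[t0 t1].
  have t2 : t < 2 by lra.
  apply: (is_derive_eq (dGM' t t2)).
  by rewrite /M; field; rewrite !gt_eqF//; lra.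
have M0 (t : R) : t \in `]0, 1[ -> 0 <= M t.
  rewrite in_itv/= => /andP[t0 t1].
  by rewrite addr_ge0// mulr_ge0// divr_ge0//; lra.
have dphiM' (t : R) : t \in `]0, 1[ -> `|dphi t| <= h * M t `^ (1 / q).
  move=> t01; apply: le_trans (dphiM t t01) _.
  move: t01; rewrite in_itv/= => /andP[t0 t1].
  rewrite le_eqVlt; apply/predU1P; left; congr (h * _ `^ _).
  rewrite !powR_inv1; try lra.
  by rewrite /M; field; rewrite !gt_eqF//; lra.
have l01 : 0 <= (0 : R) <= 1 by rewrite lexx ler01.
set Z := (2 * ln 2 - 1) * A + B.
have NE : GM 0 + GM 1 - 2 * GM 0 = 2 * Z.
  rewrite /GM /U /Z !subr0 (_ : 2 - 1 = 1); last by ring.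
  by rewrite ln1; ring.
have Z0 : 0 <= Z.
  by rewrite -(@pmulr_rge0 _ 2)// -NE (kernel_weight_ge0 l01 cGM dGM M0).
rewrite -powRM// -NE.
have := unit_kernel_bound h0 q1 l01 cphi cPhi cGM dphiE dPhiE dGM M0 dphiM'.
by rewrite mul0r add0r !subr0 mul1r expr0n/= !addr0.
Qed.

(** * Transfer from the unit interval to the halves of [[a, b]] *)

(* The right half of [[a, b]] is run backwards, from [b] to the midpoint, so
   that one statement serves both halves. *)
Lemma half_segment_bounds (R : realType) (f g F : R -> R) (a b c d q s : R) :
  a < b -> (c = a /\ d = b) \/ (c = b /\ d = a) -> 1 <= q ->
  {within `[a, b], continuous f} -> {within `[a, b], continuous F} ->
  (forall x : R, x \in `]a, b[ -> is_derive x 1 f (g x)) ->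
  (forall x : R, x \in `]a, b[ -> is_derive x 1 F (f x)) ->
  extended_s_convex s `[a, b] (fun x => `|g x| `^ q) ->
  let A := `|g c| `^ q in
  let B := `|g d| `^ q in
  let m := (c + d) / 2 in
  (forall l, 0 <= l <= 1 -> -1 < s ->
    `|l * f c + (1 - l) * f m - (F m - F c) / ((d - c) / 2)| <=
    (b - a) / 2 * ((1 / 2 - l + l ^+ 2) `^ (1 - 1 / q) *
      ((2 `^ (- s) / ((s + 1) * (s + 2))) `^ (1 / q) *
        ((2 * (2 - l) `^ (s + 2) + ((s + 2) * l - 2) * 2 `^ (s + 1)
          + (s + 2) * l - s - 3) * A
         + (2 * l `^ (s + 2) - (s + 2) * l + s + 1) * B) `^ (1 / q)))) /\
  (s = -1 ->
    `|f m - (F m - F c) / ((d - c) / 2)| <=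
    (b - a) / 2 * ((1 / 2) `^ (1 - 1 / q) *
      (2 `^ (1 / q) * ((2 * ln 2 - 1) * A + B) `^ (1 / q)))).
Proof.
move=> ab cd q1 cf cF df dF [_ _ _ conv] A B m.
(* [k] is the signed step from the outer endpoint [c] to the midpoint, negative on the right half;
   its norm is [h] in both cases. *)
pose k := (d - c) / 2; pose h := (b - a) / 2.
have h0 : 0 < h by rewrite /h; lra.
have kh : `|k| = h.
  rewrite /k /h; case: cd => -[-> ->]; first by rewrite gtr0_norm//; lra.
  by rewrite ltr0_norm; lra.
have k0 : k != 0 by rewrite -normr_eq0 kh gt_eqF.
have in_cc (t : R) : 0 <= t <= 1 -> a <= c + t * k <= b.
  move=> /andP[t0 t1].
  by rewrite /k; case: cd => -[-> ->]; apply/andP; split; nra.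
have in_oo (t : R) : t \in `]0, 1[ -> c + t * k \in `]a, b[.
  rewrite !in_itv/= => /andP[t0 t1].
  by rewrite /k; case: cd => -[-> ->]; apply/andP; split; nra.
have [abc abd] : `[a, b]%classic c /\ `[a, b]%classic d.
  by rewrite /= !in_itv/=; case: cd => -[-> ->]; rewrite !lexx (ltW ab).
have conv_in (t : R) : t \in `]0, 1[ -> `|g (c + t * k)| <=
    ((1 - t / 2) `^ s * A + (t / 2) `^ s * B) `^ (1 / q).
  rewrite in_itv/= => /andP[t0 t1].
  have t01 : 0 < 1 - t / 2 < 1 by apply/andP; split; lra.
  (* The point [c + t * k] lies at fraction [t / 2] of the way from [c] to [d], which gives the
     convexity weights. *)
  have := conv c d (1 - t / 2) abc abd t01.
  have -> : 1 - (1 - t / 2) = t / 2 by ring.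
  have -> : (1 - t / 2) * c + t / 2 * d = c + t * k by rewrite /k; field.
  have q0 : q != 0 by rewrite gt_eqF//; lra.
  rewrite -/A -/B => le_g.
  have -> : `|g (c + t * k)| = (`|g (c + t * k)| `^ q) `^ (1 / q).
    by rewrite -powRrM [q * _]mulrC divfK// powRr1.
  rewrite ge0_ler_powR ?nnegrE ?powR_ge0//.
    by rewrite div1r invr_ge0; lra.
  by rewrite addr_ge0// mulr_ge0// powR_ge0.
pose phi (t : R) : R := f (c + t * k).
(* Dividing by the signed [k] cancels the chain-rule factor in either orientation. *)
pose Phi (t : R) : R := F (c + t * k) / k.
have caff : {within `[0, 1], continuous (fun t : R => c + t * k)}.
  apply: within_continuousD; first exact: within_continuous_cst.
  apply: within_continuousM; first exact: within_continuous_id.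
  exact: within_continuous_cst.
have aff_in : {homo (fun t : R => c + t * k) :
    t / `[0, 1]%classic t >-> `[a, b]%classic t}.
  by move=> t /=; rewrite !in_itv/=; exact: in_cc.
have cphi : {within `[0, 1], continuous phi}.
  exact: within_continuous_comp_in aff_in caff cf.
have cPhi : {within `[0, 1], continuous Phi}.
  apply: within_continuousM; last exact: within_continuous_cst.
  exact: within_continuous_comp_in aff_in caff cF.
have dphi (t : R) : t \in `]0, 1[ -> is_derive t 1 phi (g (c + t * k) * k).
  by move=> t01; exact: is_derive_affine (df _ (in_oo t t01)).
have dPhi (t : R) : t \in `]0, 1[ -> is_derive t 1 Phi (phi t).
  move=> t01.
  have hd := is_deriveM (is_derive_affine (dF _ (in_oo t t01)))
    (is_derive_cst (k^-1 : R) t 1).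
  apply: (is_derive_eq hd).
  by rewrite !fctE /GRing.scale/= /phi; field.
have dphi_le (t : R) : t \in `]0, 1[ -> `|g (c + t * k) * k| <=
    h * ((1 - t / 2) `^ s * A + (t / 2) `^ s * B) `^ (1 / q).
  by move=> t01; rewrite normrM kh mulrC ler_pM2l// conv_in.
have phi0 : phi 0 = f c by rewrite /phi mul0r addr0.
have phi1 : phi 1 = f m by congr f; rewrite /k /m; field.
have Phi01 : Phi 1 - Phi 0 = (F m - F c) / k.
  rewrite /Phi mul0r addr0 -mulrBl; congr ((F _ - _) / _).
  by rewrite /k /m; field.
split=> [l l01 s1|s1].
  have := @power_weight_bound _ phi Phi _ A B h l q s h0 q1 l01 s1
    (powR_ge0 _ _) (powR_ge0 _ _) cphi cPhi dphi dPhi dphi_le.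
  by rewrite phi0 phi1 Phi01.
rewrite s1 in dphi_le.
have := @reciprocal_weight_bound _ phi Phi _ A B h q h0 q1
    (powR_ge0 _ _) (powR_ge0 _ _) cphi cPhi dphi dPhi dphi_le.
by rewrite phi1 Phi01.
Qed.

(** * Continuity from relative derivability *)

(** Writing [f (h + x)] as [f x] plus [h] times the difference quotient, the last term tends to 0
    because the quotient converges. At an endpoint of [I] this is one-sided continuity. *)
Lemma derivable_in_cvg (R : realType) (I : set R) (f : R -> R) (x : R) :
  derivable_in I f x -> f y @[y --> within I (nbhs x)] --> f x.
Proof.
move=> dfx; pose W := within [set h | I (h + x)] (0 : R)^'.
have h0 : h @[h --> W] --> (0 : R).
  apply: cvg_within_filter; apply: cvg_within_filter; exact: cvg_id.
have fh0 : h * (h^-1 *: (f (h + x) - f x)) @[h --> W] --> 0 *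
    lim (h^-1 *: (f (h + x) - f x) @[h --> W]).
  by apply: cvgM => //; exact: dfx.
have fh : f x + h * (h^-1 *: (f (h + x) - f x)) @[h --> W] --> f x.
  rewrite mul0r in fh0; rewrite -[X in _ --> X]addr0.
  by apply: cvgD => //; exact: cvg_cst.
move=> P Px.
have nP : \forall h \near (0 : R), h != 0 -> I (h + x) -> P (f (h + x)).
  have : \forall h \near (0 : R), h != 0 -> I (h + x) ->
      P (f x + h * (h^-1 *: (f (h + x) - f x))) by exact: fh.
  apply: filterS => h /= hP hn0 Ih; have := hP hn0 Ih.
  by rewrite /GRing.scale/= mulVKf// addrC subrK.
have yx : y - x @[y --> x] --> (0 : R).
  rewrite -[X in _ --> X](subrr x); apply: cvgB; [exact: cvg_id|exact: cvg_cst].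
have : \forall y \near x, y - x != 0 -> I (y - x + x) -> P (f (y - x + x)).
  exact: (yx _ nP).
apply: filterS => y /= yP Iy.
(* The punctured filter says nothing at [y = x], where [P (f x)] holds because [P] is a
   neighbourhood of [f x]. *)
have [->|ynx] := eqVneq y x; first exact: nbhs_singleton.
by move: yP; rewrite subr_eq0 subrK; exact.
Qed.

Lemma interval_subset_interior (R : realType) (I : set R) (a b : R) :
  is_interval I -> I a -> I b -> `]a, b[ `<=` I°.
Proof.
move=> itv Ia Ib x xab.
have : nbhs x `]a, b[%classic.
  by apply: open_nbhs_nbhs; split => //; exact: itv_open.
apply: filterS => y /=; rewrite in_itv/= => /andP[ay yb].
by apply: (itv a b Ia Ib); rewrite !ltW.
Qed.

(** * Averaging the two halves and matching constants *)

Lemma norm_midpoint_le (R : realType) (x y u v : R) :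
  `|x| <= u -> `|y| <= v -> `|(x + y) / 2| <= (u + v) / 2.
Proof.
by rewrite !ler_norml => /andP[? ?] /andP[? ?]; apply/andP; split; lra.
Qed.

(** The 4 collects the 2 of the half-length [(b - a) / 2] and the 2 of the average over both
    halves. *)
Lemma powR_factor_half_segment (R : realType) (s q : R) : -1 < s ->
  (2 `^ (- s) / ((s + 1) * (s + 2))) `^ (1 / q) / 4 =
  (1 / ((s + 1) * (s + 2))) `^ (1 / q) / 2 `^ (s / q + 2).
Proof.
move=> s1; have s20 : 0 <= ((s + 1) * (s + 2))^-1.
  by rewrite invr_ge0 mulr_ge0//; lra.
rewrite (powRM _ (powR_ge0 _ _) s20) -powRrM.
rewrite (_ : - s * (1 / q) = - (s / q)); last by ring.
have p0 : 2 `^ (s / q) != 0 :> R by rewrite gt_eqF ?powR_gt0.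
rewrite powRN powRD; last by rewrite pnatr_eq0 implybT.
by rewrite powR_mulrn// !mul1r; field.
Qed.

(** The same normalization at [s = -1]: both sides are 2 to the power [2 / q - 3]. *)
Lemma powR_half_segment (R : realType) (q : R) : q != 0 ->
  (1 / 2) `^ (1 - 1 / q) * 2 `^ (1 / q) / 4 = 1 / 2 `^ (3 - 2 / q) :> R.
Proof.
move=> q0.
have p0 : 2 `^ (1 / q) != 0 :> R by rewrite gt_eqF ?powR_gt0.
have -> : 2 `^ (3 - 2 / q) = 8 / (2 `^ (1 / q) * 2 `^ (1 / q)) :> R.
  rewrite powRB; last by rewrite pnatr_eq0 implybT.
  rewrite powR_mulrn//; congr (_ / _); first by rewrite -natrX.
  rewrite -powRD; last by rewrite pnatr_eq0 implybT.
  by rewrite -mulrDl.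
have -> : (1 / 2) `^ (1 - 1 / q) = 2 `^ (1 / q) / 2 :> R.
  rewrite div1r -(@powR_inv1 _ 2)// -powRrM mulN1r opprB.
  by rewrite powRD// pnatr_eq0 implybT.
by field.
Qed.

(** Abstracting the powers to variables leaves plain field algebra. *)
Lemma average_factor (R : realType) (c K L D p1 z1 p2 z2 : R) :
  K / 4 = L / D ->
  (c / 2 * (p1 * (K * z1)) + c / 2 * (p2 * (K * z2))) / 2 =
  c / D * L * (p1 * z1 + p2 * z2).
Proof.
move=> KL; have -> : c / D * L = c * (L / D) by rewrite -mulrA [_ * L]mulrC.
by rewrite -KL; field.
Qed.

(** * The inequalities on [[a, b]] *)

Theorem theorem3p1 (R : realType) (I : set R) (f : R -> R) (a b : R)
    (lambda mu q s : R)
    (I_itv : is_interval I) (I_ge0 : I `<=` `[0, +oo[)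
    (f_diff : forall x, I° x -> derivable f x 1)
    (Ia : I a) (Ib : I b) (ab : a < b)
    (f_diff_ab : forall x, x \in `[a, b] -> derivable_in I f x)
    (df_int : (@lebesgue_measure R).-integrable `[a, b]
                (fun x => (derive1_in I f x)%:E))
    (lambda01 : 0 <= lambda <= 1) (mu01 : 0 <= mu <= 1)
    (q_ge1 : 1 <= q) (s_itv : -1 <= s <= 1)
    (df_convex :
       extended_s_convex s `[a, b] (fun x => `|derive1_in I f x| `^ q)) :
  let A := `|derive1_in I f a| `^ q in
  let B := `|derive1_in I f b| `^ q in
  let mean := (b - a)^-1 * \int[@lebesgue_measure R]_(x in `[a, b]) f x in
  (-1 < s ->
    `|(lambda * f a + mu * f b) / 2
      + (2 - lambda - mu) / 2 * f ((a + b) / 2) - mean|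
    <= (b - a) / 2 `^ (s / q + 2)
       * (1 / ((s + 1) * (s + 2))) `^ (1 / q)
       * ((1 / 2 - lambda + lambda ^+ 2) `^ (1 - 1 / q)
          * ((2 * (2 - lambda) `^ (s + 2)
              + ((s + 2) * lambda - 2) * 2 `^ (s + 1)
              + (s + 2) * lambda - s - 3) * A
             + (2 * lambda `^ (s + 2) - (s + 2) * lambda + s + 1) * B)
            `^ (1 / q)
        + (1 / 2 - mu + mu ^+ 2) `^ (1 - 1 / q)
          * ((2 * mu `^ (s + 2) - (s + 2) * mu + s + 1) * A
             + (2 * (2 - mu) `^ (s + 2)
                + ((s + 2) * mu - 2) * 2 `^ (s + 1)
                + (s + 2) * mu - s - 3) * B)
            `^ (1 / q)))
  /\
  (s = -1 ->
    `|f ((a + b) / 2) - mean|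
    <= (b - a) / 2 `^ (3 - 2 / q)
       * (((2 * ln 2 - 1) * A + B) `^ (1 / q)
          + (A + (2 * ln 2 - 1) * B) `^ (1 / q))).
Proof.

move=> A B mean.
pose g := derive1_in I f.
have ab_sub : `[a, b] `<=` I.
  by move=> x; rewrite /= in_itv/=; exact: I_itv Ia Ib x.
have ab_int : `]a, b[ `<=` I° by exact: interval_subset_interior.
(* At [a] and [b], which may be endpoints of [I], continuity comes from derivability relative to
   [I]. *)
have cf : {within `[a, b], continuous f}.
  apply/subspace_continuousP => x xab.
  move=> P Px.
  have IP : \forall y \near x, I y -> P (f y).
    exact: (derivable_in_cvg (f_diff_ab x xab) Px).
  have : \forall y \near x, `[a, b]%classic y -> P (f y).
    by apply: filterS IP => y yP /ab_sub.
  exact.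
have df (x : R) : x \in `]a, b[ -> is_derive x 1 f (g x).
  move=> /ab_int xI; rewrite /g derive1_inE// derive1E.
  exact/derivableP/f_diff.
(* By the fundamental theorem of calculus [F] is a primitive of the continuous [f], and [F b - F a]
   is its integral. *)
pose F := parameterized_integral (@lebesgue_measure R) a ^~ f.
have intf : (@lebesgue_measure R).-integrable `[a, b] (EFin \o f).
  by apply: continuous_compact_integrable => //; exact: segment_compact.
have cF : {within `[a, b], continuous F}.
  exact: parameterized_integral_continuous (ltW ab) intf.
have dF (x : R) : x \in `]a, b[ -> is_derive x 1 F (f x).
  move=> xab; have := xab; rewrite in_itv/= => /andP[ax xb].
  have [dFx <-] := continuous_FTC1_closed xb intf ax
    (within_continuous_continuous ab cf xab).
  by rewrite derive1E; exact/derivableP.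
have meanE : mean = (b - a)^-1 * (F b - F a).
  rewrite /mean /F /parameterized_integral; congr (_ * _).
  by rewrite set_itv1 Rintegral_set1 subr0.
have [left_s left_1] := half_segment_bounds ab
  (or_introl (conj (erefl a) (erefl b))) q_ge1 cf cF df dF df_convex.
have [right_s right_1] := half_segment_bounds ab
  (or_intror (conj (erefl b) (erefl a))) q_ge1 cf cF df dF df_convex.
move: left_s left_1 right_s right_1; rewrite -/g [b + a]addrC -/A -/B.
set m := (a + b) / 2 => left_s left_1 right_s right_1.
clearbody A B m.
(* On the right half the outer endpoint is [b], so [A] and [B] exchange roles. *)
have swapBA u v : u * B + v * A = v * A + u * B by rewrite addrC.
have ba0 : 0 < b - a by rewrite subr_gt0.
have ab_neq : b - a != 0 by rewrite gt_eqF.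
(* The reversed right half brings in the denominator [a - b]. *)
have ba_neq : a - b != 0 by rewrite -opprB oppr_eq0.
have q0 : q != 0 by rewrite gt_eqF// (lt_le_trans ltr01).
split=> [s1|s1].
- have {}left_s := left_s lambda lambda01 s1.
  have {}right_s := right_s mu mu01 s1.
  set X1 := (X in `|X| <= _) in left_s.
  set X2 := (X in `|X| <= _) in right_s.
  (* The total error is the average of the errors on the two halves, with [l = lambda] on the left
     and [l = mu] on the right. *)
  have -> : (lambda * f a + mu * f b) / 2 + (2 - lambda - mu) / 2 * f m - mean =
      (X1 + X2) / 2.
    by rewrite meanE /X1 /X2; field; rewrite ab_neq ba_neq.
  apply: le_trans (norm_midpoint_le left_s right_s) _.
  rewrite le_eqVlt; apply/predU1P; left.
  rewrite swapBA.
  exact: average_factor (powR_factor_half_segment q s1).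
- have {}left_1 := left_1 s1; have {}right_1 := right_1 s1.
  set X1 := (X in is_true (`|X| <= _)) in left_1.
  set X2 := (X in is_true (`|X| <= _)) in right_1.
  have -> : f m - mean = (X1 + X2) / 2.
    by rewrite meanE /X1 /X2; field; rewrite ab_neq ba_neq.
  apply: le_trans (norm_midpoint_le left_1 right_1) _.
  rewrite le_eqVlt; apply/predU1P; left.
  rewrite [(2 * ln 2 - 1) * B + A]addrC.
  have -> : (b - a) / 2 `^ (3 - 2 / q) = (b - a) * (1 / 2 `^ (3 - 2 / q)).
    by rewrite mul1r.
  by rewrite -(powR_half_segment q0); field.
Qed.
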